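(* Let $R$ be a commutative ring and let $M$ be a faithful $R$-module. If $\omega(G_M(R))$ is finite, then $|\mathrm{Max}(R)|\leq \omega(G_M(R))+1$ and $J(R)=\mathrm{Nil}(R)$.
   Context: All rings are commutative with non-zero identity and all modules are unitary. $I(R)^*$ denotes the set of all non-trivial ideals of $R$, i.e. ideals $I$ with $I\neq 0$ and $I\neq R$. For a non-zero $R$-module $M$, the $M$-intersection graph of ideals of $R$, denoted $G_M(R)$, is the (simple) graph with vertex set $I(R)^*$ in which two distinct vertices $I$ and $J$ are adjacent if and only if $IM\cap JM\neq 0$. $M$ is faithful if $\mathrm{ann}(M)=0$, where $\mathrm{ann}(M)$ is the annihilator of $M$ in $R$. $\mathrm{Max}(R)$ is the set of maximal ideals of $R$, $J(R)$ is the Jacobson radical of $R$, and $\mathrm{Nil}(R)$ is the ideal of all nilpotent elements of $R$. $\omega(G)$ denotes the clique number of a graph $G$, i.e. the number of vertices in a largest set of pairwise adjacent vertices (equal to $0$ if $G$ has no vertices). *)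

(* Defs.v *)
From HB Require Import structures.
From mathcomp Require Import all_boot all_order all_algebra.
From mathcomp Require Import boolp classical_sets functions cardinality.

Set Implicit Arguments.
Unset Strict Implicit.
Unset Printing Implicit Defensive.

Import GRing.Theory.

Local Open Scope classical_set_scope.
Local Open Scope card_scope.
Local Open Scope ring_scope.

(* Vertices are a set in an ambient type T, which may be infinite. *)
Record simple_graph (T : Type) := SimpleGraph {
  vertices : set T;
  adjacent : T -> T -> Prop;
  adjacent_vertices : forall x y, adjacent x y -> vertices x /\ vertices y;
  adjacent_sym : forall x y, adjacent x y -> adjacent y x;
  adjacent_irrefl : forall x, ~ adjacent x x
}.

Definition is_clique (T : Type) (G : simple_graph T) (C : set T) : Prop :=
  C `<=` vertices G /\
  forall x y, C x -> C y -> x <> y -> adjacent G x y.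

(* [has_clique_number G w] states that the clique number of G is finite and    *)
(* equal to w. At most one w qualifies, and none does when G has arbitrarily   *)
(* large (or infinite) cliques. The empty set is a clique, so w = 0 when G has *)
(* no vertices.                                                                *)
Definition has_clique_number (T : Type) (G : simple_graph T) (w : nat) : Prop :=
  (exists2 C : set T, is_clique G C & C #= `I_w) /\
  (forall C : set T, is_clique G C -> C #<= `I_w).

(* Ideals are the submodules of the regular module R^o; unlike the library's   *)
(* [idealr_closed], this allows the whole ring.                                *)
Definition is_ideal (R : comNzRingType) (I : set R) : Prop :=
  GRing.submod_closed [in (I : set R^o)].

Definition nontrivial_ideals (R : comNzRingType) : set (set R) :=
  [set I | [/\ is_ideal I, I <> [set 0] & I <> [set: R]]].
Arguments nontrivial_ideals R : clear implicits.

Definition Max (R : comNzRingType) : set (set R) :=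
  [set I | [/\ is_ideal I, I <> [set: R] &
    forall J : set R, is_ideal J -> J <> [set: R] -> I `<=` J -> J = I]].
Arguments Max R : clear implicits.

Definition jacobson_radical (R : comNzRingType) : set R :=
  \bigcap_(m in Max R) m.
Arguments jacobson_radical R : clear implicits.

Definition nilradical (R : comNzRingType) : set R :=
  [set x : R | exists n : nat, x ^+ n = 0].
Arguments nilradical R : clear implicits.

Definition annihilator (R : comNzRingType) (M : lmodType R) : set R :=
  [set a : R | forall m : M, a *: m = 0].
Arguments annihilator [R] M.

Definition faithful_module (R : comNzRingType) (M : lmodType R) : Prop :=
  annihilator M = [set 0].
Arguments faithful_module [R] M.

(* The submodule I M, i.e. the set of all finite sums of products a *: m. *)
Definition ideal_mul (R : comNzRingType) (M : lmodType R) (I : set R) : set M :=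
  [set x : M | exists n (a : 'I_n -> R) (m : 'I_n -> M),
    (forall i, I (a i)) /\ x = \sum_(i < n) a i *: m i].
Arguments ideal_mul [R] M I.

Definition intersection_adjacent (R : comNzRingType) (M : lmodType R)
    (I J : set R) : Prop :=
  [/\ nontrivial_ideals R I, nontrivial_ideals R J, I <> J &
      ideal_mul M I `&` ideal_mul M J <> [set 0]].
Arguments intersection_adjacent [R] M I J.

Section IntersectionGraph.
Variables (R : comNzRingType) (M : lmodType R).

Lemma intersection_adjacent_vertices (I J : set R) :
  intersection_adjacent M I J -> nontrivial_ideals R I /\ nontrivial_ideals R J.
Proof. by case. Qed.

Lemma intersection_adjacent_sym (I J : set R) :
  intersection_adjacent M I J -> intersection_adjacent M J I.
Proof. by case=> hI hJ hIJ h; split=> //; [exact/nesym | rewrite setIC]. Qed.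

Lemma intersection_adjacent_irrefl (I : set R) : ~ intersection_adjacent M I I.
Proof. by case. Qed.

Definition intersection_graph : simple_graph (set R) :=
  SimpleGraph intersection_adjacent_vertices intersection_adjacent_sym
    intersection_adjacent_irrefl.

End IntersectionGraph.
Arguments intersection_graph [R] M.

(* Main.v *)
Require Import Defs.
From mathcomp Require Import all_boot all_order all_algebra.
From mathcomp Require Import boolp classical_sets functions cardinality.
From mathcomp Require Import ring.

(** A strictly decreasing chain of nontrivial ideals is a clique: its members
    meet in the smallest one, whose product with the faithful module [M] is
    nonzero. Hence such chains have length at most [w]. If [m_0, ..., m_n] are
    distinct maximal ideals, then [m_0], [m_0 `&` m_1], ...,
    [m_0 `&` ... `&` m_(n-1)] is such a chain. If [x] lies in the Jacobson
    radical and is not nilpotent, then the powers of [x] generate arbitrarily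
    long such chains: [x^i = r x^j] with [i < j] would give
    [x^i (1 - r x^(j-i)) = 0], where the second factor is a unit. *)

Set Implicit Arguments.
Unset Strict Implicit.
Unset Printing Implicit Defensive.

Import GRing.Theory.

Local Open Scope classical_set_scope.
Local Open Scope card_scope.
Local Open Scope ring_scope.

(** Turns the failure of a cardinality bound into [n.+1] distinct elements of [A], whether [A] is
    finite or infinite. *)
Lemma not_card_le_I (T : Type) (A : set T) (n : nat) :
  ~ (A #<= `I_n) -> `I_n.+1 #<= A.
Proof.
move=> An; have [/finite_setP[m Am]|infA] := pselect (finite_set A).
  rewrite (card_le_eqr Am) card_le_II ltnNge; apply/negP => mn; apply: An.
  by rewrite (card_le_eql Am) card_le_II.
by apply: card_le_trans ((infiniteP A).1 infA); apply: subset_card_le.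
Qed.

Section Ideals.
Variable R : comNzRingType.
Implicit Types (I J : set R) (x y : R).

Lemma is_idealP I :
  is_ideal I <-> I 0 /\ forall a x y, I x -> I y -> I (a * x + y).
Proof.
split=> [[I0 Il]|[I0 Il]].
  split=> [|a x y Ix Iy]; first by move: I0; rewrite inE.
  by have := Il a x y; rewrite !inE => /(_ Ix Iy).
split; first by rewrite inE.
by move=> a x y; rewrite !inE; exact: Il.
Qed.

Lemma ideal_mull I a x : is_ideal I -> I x -> I (a * x).
Proof. by move=> /is_idealP[I0 Il] Ix; rewrite -[_ * _]addr0; exact: Il. Qed.

Lemma ideal_proper I : is_ideal I -> I <> [set: R] <-> ~ I 1.
Proof.
move=> idI; split=> [IT I1|I1 IT]; last by apply: I1; rewrite IT.
by apply: IT; rewrite -subTset => x _; rewrite -[x]mulr1; exact: ideal_mull.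
Qed.

Definition principal_ideal x : set R := range (fun r => r * x).

Lemma principal_ideal_id x : principal_ideal x x.
Proof. by exists 1; rewrite ?mul1r. Qed.

Lemma is_ideal_principal x : is_ideal (principal_ideal x).
Proof.
apply/is_idealP; split=> [|a _ _ [r _ <-] [s _ <-]].
  by exists 0; rewrite ?mul0r.
by exists (a * r + s) => //; ring.
Qed.

Lemma is_ideal_add_principal I x :
  is_ideal I -> is_ideal [set r * x + y | r in [set: R] & y in I].
Proof.
move=> /is_idealP[I0 Il]; apply/is_idealP; split.
  by exists 0 => //; exists 0 => //; rewrite mul0r addr0.
move=> a _ _ [r _ [y Iy <-]] [s _ [z Iz <-]].
by exists (a * r + s) => //; exists (a * y + z); [exact: Il|ring].
Qed.

Lemma is_ideal_bigcap (T : Type) (P : set T) (F : T -> set R) :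
  (forall i, P i -> is_ideal (F i)) -> is_ideal (\bigcap_(i in P) F i).
Proof.
move=> idF; apply/is_idealP; split=> [i Pi|a x y Fx Fy i Pi].
  by case/is_idealP: (idF i Pi).
by case/is_idealP: (idF i Pi) => _; apply; [exact: Fx|exact: Fy].
Qed.

(** If [x] is outside [I], then [(x) + I] is the whole ring; multiplying [1 = r * x + z] by [y] puts
    [y] in [I]. *)
Lemma maximal_ideal_prime I x y : Max R I -> I (x * y) -> I x \/ I y.
Proof.
move=> [idI IT Imax] Ixy; have [|Ix] := pselect (I x); [by left|right].
set J := [set r * x + y | r in [set: R] & y in I].
have idJ : is_ideal J by exact: is_ideal_add_principal.
have [I0 Il] := (is_idealP I).1 idI.
have IJ : I `<=` J.
  by move=> z Iz; exists 0 => //; exists z => //; rewrite mul0r add0r.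
have [r _ [z Iz rz1]] : J 1.
  apply: contrapT => /(ideal_proper idJ) JT; apply: Ix.
  rewrite -(Imax J) //; exists 1 => //; exists 0 => //.
  by rewrite mul1r addr0.
have -> : y = r * (x * y) + y * z by rewrite -[LHS]mulr1 -rz1; ring.
by apply: Il => //; exact: ideal_mull.
Qed.

Lemma maximal_ideal_exp I x n : Max R I -> I (x ^+ n) -> I x.
Proof.
move=> MI; elim: n => [|n IHn].
  by case: MI => idI /(ideal_proper idI) I1 _; rewrite expr0.
by rewrite exprS => /(maximal_ideal_prime MI)[].
Qed.

Lemma maximal_ideal_inj I J : Max R I -> Max R J -> I `<=` J -> I = J.
Proof. by move=> [_ _ Imax] [idJ JT _] IJ; rewrite (Imax J). Qed.

(** Krull's theorem: Zorn's lemma applies because a union of a chain of ideals avoiding [1] still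
    avoids [1]. *)
Lemma maximal_ideal_above I :
  is_ideal I -> I <> [set: R] -> exists2 J, Max R J & I `<=` J.
Proof.
move=> idI /(ideal_proper idI) I1.
(* Taking the union with [I] makes the empty chain harmless in Zorn's lemma. *)
pose P : set (set R) := [set A | is_ideal (I `|` A) /\ ~ (I `|` A) 1].
have [I0 Il] := (is_idealP I).1 idI.
have [F FP Ftot|A [[idA A1] Amax]] := @Zorn_bigcup _ P.
  split; last by move=> [//|[X FX X1]]; case: (FP X FX) => _; apply; right.
  apply/is_idealP; split=> [|a x y]; first by left.
  have step X : F X -> (I `|` X) x -> (I `|` X) y ->
      (I `|` \bigcup_(X in F) X) (a * x + y).
    move=> FX Xx Xy; have [/is_idealP[_ Xl] _] := FP X FX.
    by case: (Xl a x y Xx Xy) => [?|?]; [left|right; exists X].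
  move=> [Ix|[X FX Xx]] [Iy|[Y FY Yy]].
  - by left; exact: Il.
  - by apply: (step Y) => //; [left|right].
  - by apply: (step X) => //; [right|left].
  (* Of two comparable members of the chain, the larger contains both [x] and [y]. *)
  - case: (Ftot X Y FX FY) => [XY|YX].
      by apply: (step Y) => //; right=> //; exact: XY.
    by apply: (step X) => //; right=> //; exact: YX.
exists (I `|` A); last exact: subsetUl.
split=> // [|J idJ JT AJ]; first exact/ideal_proper.
have IJ : I `|` J = J.
  by apply: setUidr; apply: subset_trans AJ; exact: subsetUl.
have PJ : P J by split; rewrite IJ //; exact/(ideal_proper idJ).
apply/seteqP; split=> //; apply: contrapT => nJA.
apply: (Amax J) PJ; split=> [|JA].
  by apply: subset_trans AJ; exact: subsetUr.
by apply: nJA; apply: subset_trans JA _; exact: subsetUr.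
Qed.

(** Otherwise [1 - r * x] lies in some maximal ideal, which also contains [x] and hence [1]. *)
Lemma jacobson_radical_unit x r :
  jacobson_radical R x -> exists s, s * (1 - r * x) = 1.
Proof.
move=> Jx; set I := principal_ideal (1 - r * x).
have idI : is_ideal I by exact: is_ideal_principal.
suff [s _ s1] : I 1 by exists s.
apply: contrapT => /(ideal_proper idI) IT.
have [m Mm Im] := maximal_ideal_above idI IT.
have [idm /(ideal_proper idm) m1 _] := Mm; apply: m1.
have -> : 1 = r * x + (1 - r * x) by ring.
case/is_idealP: (idm) => _; apply; first exact: Jx.
exact/Im/principal_ideal_id.
Qed.

Lemma nilradical_sub_jacobson : nilradical R `<=` jacobson_radical R.
Proof.
move=> x [n xn0] m Mm; apply: (@maximal_ideal_exp _ _ n) => //.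
by case: Mm => /is_idealP[m0 _] _ _; rewrite xn0.
Qed.

Section Chains.
Variables (M : lmodType R) (w : nat).
Hypothesis M_faithful : faithful_module M.
Hypothesis omega_eq : has_clique_number (intersection_graph M) w.

Lemma ideal_mulS I J : I `<=` J -> ideal_mul M I `<=` ideal_mul M J.
Proof.
by move=> IJ _ [n [a [m [Ia ->]]]]; exists n, a, m; split=> // i; exact: IJ.
Qed.

(** If the product vanished, every element of [I] would annihilate [M]. *)
Lemma ideal_mul_neq0 I : is_ideal I -> I <> [set 0] -> ideal_mul M I <> [set 0].
Proof.
move=> /is_idealP[I0 _] In0 IM0; apply: In0; apply/seteqP.
split=> [a Ia|_ ->//]; rewrite -M_faithful => v.
suff : ideal_mul M I (a *: v) by rewrite IM0.
by exists 1, (fun=> a), (fun=> v); rewrite big_ord1.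
Qed.

Lemma ideal_chain_size (n : nat) (f : nat -> set R) :
  (forall i, (i < n)%N -> nontrivial_ideals R (f i)) ->
  (forall i j, (i < j < n)%N -> f j `<=` f i /\ f j <> f i) ->
  (n <= w)%N.
Proof.
move=> f_nt f_dec; have [_ /(_ (f @` `I_n))] := omega_eq.
have f_inj : {in `I_n &, injective f}.
  move=> i j; rewrite !inE /= => ilt jlt fij; case: (ltngtP i j) => // ij.
    by have [_ []] : f j `<=` f i /\ f j <> f i by apply: f_dec; rewrite ij.
  by have [_ []] : f i `<=` f j /\ f i <> f j by apply: f_dec; rewrite ij.
rewrite (card_le_eql (inj_card_eq f_inj)) card_le_II; apply.
split=> [_ [i ilt <-]|_ _ [i ilt <-] [j jlt <-]]; first exact: f_nt.
wlog ij : i j ilt jlt / (i < j)%N.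
  move=> th fij; case: (ltngtP i j) => ij; first exact: th.
    by apply: adjacent_sym; apply: th => //; exact: nesym.
  by rewrite ij in fij.
move=> fij; split=> //; [exact: f_nt|exact: f_nt|].
have [fji _] : f j `<=` f i /\ f j <> f i by apply: f_dec; rewrite ij.
rewrite (setIidr (ideal_mulS fji)).
by have [idj jn0 _] := f_nt j jlt; exact: ideal_mul_neq0.
Qed.

Lemma card_max_ideals : Max R #<= `I_w.+1.
Proof.
(* Suppose there are [w + 2] distinct maximal ideals [m 0], ..., [m w.+1]. *)
apply: contrapT => /not_card_le_I /pcard_leP[m].
have mM i : (i < w.+2)%N -> Max R (m i) by move=> iw; exact: (@funS _ _ _ _ m).
pose f k := \bigcap_(i in `I_k.+1) m i.
have f_sub i j : (i <= j)%N -> f j `<=` f i.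
  by move=> ij x fx k /= ki; apply: fx => /=; exact: leq_trans ki _.
have idf k : (k < w.+2)%N -> is_ideal (f k).
  move=> kw; apply: is_ideal_bigcap => i /= ik.
  by have [] := mM i (leq_trans ik kw).
(* An element of all the earlier maximal ideals but not of [m k]: the product
   of elements separating each of them from [m k], as [m k] is prime. *)
have separate k n : (k < w.+2)%N -> (n <= k)%N ->
    exists2 x, forall i, (i < n)%N -> m i x & ~ m k x.
  move=> kw; elim: n => [_|n IHn nk].
    exists 1 => //; have [idk kT _] := mM k kw.
    exact/(ideal_proper idk).
  have [x mx nx] := IHn (ltnW nk).
  have nw : (n < w.+2)%N by exact: ltn_trans kw.
  (* Distinct maximal ideals are incomparable. *)
  have [y my ny] : exists2 y, m n y & ~ m k y.
    apply: contrapT => nsep; have : m n = m k.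
      apply: maximal_ideal_inj; [exact: mM|exact: mM|move=> y my].
      by apply: contrapT => ny; apply: nsep; exists y.
    move/(@inj _ _ _ m); rewrite !inE => /(_ nw kw) nk'.
    by rewrite nk' ltnn in nk.
  exists (x * y); last by move/(maximal_ideal_prime (mM k kw)) => [].
  move=> i; rewrite ltnS leq_eqVlt => /predU1P[->|ilt].
    by apply: ideal_mull => //; case: (mM n nw).
  rewrite mulrC; apply: ideal_mull; last exact: mx.
  by case: (mM i (ltn_trans ilt nw)).
suff : (w.+1 <= w)%N by rewrite ltnn.
apply: (@ideal_chain_size _ f) => [i iw|i j /andP[ij jw]].
  split; first by apply: idf; exact: ltnW.
    (* An element of [f i] outside [m i.+1] is nonzero. This needs one more maximal ideal than [f i]
       involves, so the chain stops at [f w]. *)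
    move=> fi0; have [x mx nx] := @separate i.+1 i.+1 iw (leqnn _).
    have : f i x by move=> k; exact: mx.
    rewrite fi0 => /= x0; apply: nx; rewrite x0.
    by case: (mM i.+1 iw) => /is_idealP[].
  have [id0 /(ideal_proper id0) m0 _] := mM 0%N isT.
  by move=> fT; apply: m0; have : f i 1 by [rewrite fT]; apply.
split; first by apply: f_sub; exact: ltnW.
(* This [x] lies in [f i], as [i < j], but not in [f j]. *)
move=> fij; have [x mx nx] := @separate j j (ltnW jw) (leqnn _).
have : f i x by move=> k /= ki; apply: mx; exact: leq_trans ki _.
by rewrite -fij => fx; apply: nx; apply: fx => /=.
Qed.

Lemma jacobson_sub_nilradical : jacobson_radical R `<=` nilradical R.
Proof.
move=> x Jx; apply: contrapT => xnil.
have notin i j : (i < j)%N -> ~ principal_ideal (x ^+ j) (x ^+ i).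
  move=> ij [r _ xij]; apply: xnil; exists i.
  (* One factor [x] is split off [x ^+ (j - i)], so that the unit has the form [1 - r' * x]. *)
  have [s s1] := jacobson_radical_unit (r * x ^+ (j - i.+1)) Jx.
  have xj : x ^+ j = x ^+ (j - i.+1) * x * x ^+ i.
    by rewrite -exprSr -exprD -subSn // subSS subnK // ltnW.
  have e : (1 - r * x ^+ (j - i.+1) * x) * x ^+ i = 0.
    by rewrite mulrBl mul1r -{1}xij xj; ring.
  by rewrite -[LHS]mul1r -s1 -[LHS]mulrA e mulr0.
suff : (w.+1 <= w)%N by rewrite ltnn.
(* Exponents start at 1, since [x ^+ 0] generates the whole ring, which is not a vertex. *)
apply: (@ideal_chain_size _ (fun i => principal_ideal (x ^+ i.+1))).
  move=> i _; split; first exact: is_ideal_principal.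
    move=> xi0; apply: xnil; exists i.+1.
    by have := principal_ideal_id (x ^+ i.+1); rewrite xi0.
  by move=> xiT; apply: (@notin 0%N i.+1) => //; rewrite xiT.
move=> i j /andP[ij _]; split.
  move=> _ [r _ <-]; exists (r * x ^+ (j - i)) => //.
  by rewrite -mulrA -exprD addnS subnK // ltnW.
move=> xij; apply: (@notin i.+1 j.+1) => //.
by rewrite xij; exact: principal_ideal_id.
Qed.

End Chains.
End Ideals.

Theorem theorem6 (R : comNzRingType) (M : lmodType R)
    (M_nonzero : [set: M] <> [set 0]) (M_faithful : faithful_module M)
    (w : nat) (omega_eq : has_clique_number (intersection_graph M) w) :
  Max R #<= `I_(w + 1) /\ jacobson_radical R = nilradical R.
Proof.
split; first by rewrite addn1; exact: card_max_ideals M_faithful omega_eq.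
apply/seteqP; split; last exact: nilradical_sub_jacobson.
exact: jacobson_sub_nilradical M_faithful omega_eq.
Qed.
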